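(* Let $d=2s+1$ be odd, $\mathcal{A}\in\mathrm{S}^d(\mathbb{R}^2)$, $T=\begin{pmatrix}1&1\\0&1\end{pmatrix}$, and $y=(y_0,\dots,y_{2s+1})=\mathfrak{B}(\mathscr{L}_T(\mathcal{A}))$. Assume $y_0>0$, $H_3(y)\succeq0$, $H_4(y)\succeq0$, and let $r=\operatorname{rank}H_1(y)$. Then: (i) The linear system in unknowns $g_0,\dots,g_{r-1}$ $$\sum_{j=0}^{r-1}y_{i+j}\,g_j=y_{i+r}\qquad(i=0,1,\dots,2s+1-r)$$ has a unique solution. (ii) For this solution, the polynomial $g(x)=g_0+g_1x+\cdots+g_{r-1}x^{r-1}-x^r$ has $r$ roots $x_1,\dots,x_r$ which are all distinct and belong to $[0,1]$, and there exists a unique vector $(\lambda_1,\dots,\lambda_r)$ with all $\lambda_i>0$ satisfying $y=\lambda_1[x_1]_d+\cdots+\lambda_r[x_r]_d$. Consequently $$\mathcal{A}=\begin{pmatrix}a_1\\ b_1\end{pmatrix}^{\otimes d}+\cdots+\begin{pmatrix}a_r\\ b_r\end{pmatrix}^{\otimes d},\quad a_i=\lambda_i^{1/d}(1-x_i)\ge0,\ b_i=\lambda_i^{1/d}x_i\ge0.$$ (iii) The $r$-atomic representing measure for $y$ is unique. (iv) The cp-rank of $\mathcal{A}$ is $r$, and the cp-rank decomposition given in (ii) is the unique cp-rank decomposition of $\mathcal{A}$.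
   Context: $\mathrm{S}^d(\mathbb{R}^2)$ is the space of real symmetric tensors of order $d$ and dimension $2$; $v^{\otimes d}$ has entries $v_{i_1}\cdots v_{i_d}$. $\mathscr{L}_T$ is the linear map $(\mathscr{L}_T\mathcal{X})_{i_1\dots i_d}=\sum_{j_1,\dots,j_d}T_{i_1j_1}\cdots T_{i_dj_d}\mathcal{X}_{j_1\dots j_d}$. For $\mathcal{X}\in\mathrm{S}^d(\mathbb{R}^2)$, $\mathfrak{B}(\mathcal{X})=(x_0,\dots,x_d)$ with $x_k=\mathcal{X}_{i_1\dots i_d}$ whenever $i_1+\cdots+i_d-d=k$. $[t]_d:=(1,t,\dots,t^d)$. $X\succeq0$ means positive semidefinite. With indices from $0$: $H_1(y)=(y_{i+j})_{0\le i,j\le s}$, $H_3(y)=(y_{i+j+1})_{0\le i,j\le s}$, $H_4(y)=(y_{i+j}-y_{i+j+1})_{0\le i,j\le s}$. A representing measure for $y=(y_0,\dots,y_d)$ is a Borel measure $\mu$ on $\mathbb{R}$ with $y_k=\int x^k\,d\mu$ for $k=0,\dots,d$; it is $r$-atomic if its support has exactly $r$ points. A cp-decomposition of $\mathcal{A}$ is an expression $\mathcal{A}=\sum_{i=1}^r v_i^{\otimes d}$ with $v_i\in\mathbb{R}^2_+$; the cp-rank is the smallest such $r$, and a cp-decomposition of that length is a cp-rank decomposition (uniqueness is up to reordering of summands). *)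

(* Defs.v *)
From HB Require Import structures.
From mathcomp Require Import all_boot all_order all_fingroup all_algebra.
From mathcomp Require Import all_classical all_reals all_analysis.
Set Implicit Arguments. Unset Strict Implicit. Unset Printing Implicit Defensive.
Import Order.TTheory GRing.Theory Num.Theory.
Import numFieldNormedType.Exports.
Local Open Scope classical_set_scope.
Local Open Scope ring_scope.

Definition tensor (R : Type) (d : nat) := d.-tuple 'I_2 -> R.

Definition symmetric_tensor (R : Type) (d : nat) (X : tensor R d) :=
  forall (i : d.-tuple 'I_2) (p : {perm 'I_d}), X [tuple tnth i (p j) | j < d] = X i.

Definition tpow (R : realType) (d : nat) (v : 'cV[R]_2) : tensor R d :=
  fun i => \prod_(k < d) v (tnth i k) 0.

Definition LT (R : realType) (d : nat) (T : 'M[R]_2) (X : tensor R d) : tensor R d :=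
  fun i => \sum_(j : d.-tuple 'I_2) (\prod_(k < d) T (tnth i k) (tnth j k)) * X j.

Definition Tmat (R : realType) : 'M[R]_2 :=
  \matrix_(i < 2, j < 2) (if (i <= j)%N then 1 else 0).

(* index tuple with exactly k entries equal to 1 (0-based indices sum to k);
   with 1-based indices this is i_1+...+i_d-d = k *)
Definition bidx (d k : nat) : d.-tuple 'I_2 :=
  [tuple (if (d - k <= j)%N then (1 : 'I_2) else 0) | j < d].

Definition Bvec (R : realType) (d : nat) (X : tensor R d) (k : nat) : R :=
  X (bidx d k).

Definition H1 (R : realType) (s : nat) (y : nat -> R) : 'M[R]_s.+1 :=
  \matrix_(i, j) y (i + j)%N.
Definition H3 (R : realType) (s : nat) (y : nat -> R) : 'M[R]_s.+1 :=
  \matrix_(i, j) y (i + j + 1)%N.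
Definition H4 (R : realType) (s : nat) (y : nat -> R) : 'M[R]_s.+1 :=
  \matrix_(i, j) (y (i + j)%N - y (i + j + 1)%N).

(* positive semidefinite (the matrices above are symmetric) *)
Definition psd (R : realType) (n : nat) (M : 'M[R]_n) :=
  forall v : 'cV[R]_n, 0 <= (v^T *m M *m v) 0 0.

Definition mvec (R : realType) (d : nat) (t : R) (k : nat) : R := t ^+ k.

Definition represents (R : realType) (mu : {measure set R -> \bar R})
    (d : nat) (y : nat -> R) :=
  forall k, (k <= d)%N ->
    mu.-integrable setT (fun x => (x ^+ k)%:E) /\
    (\int[mu]_x (x ^+ k)%:E = (y k)%:E)%E.

Definition msupport (R : realType) (mu : {measure set R -> \bar R}) : set R :=
  [set x : R | forall e : R, 0 < e -> (0 < mu [set z : R | (`|z - x| < e)%R])%E].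

Definition ratomic (R : realType) (mu : {measure set R -> \bar R}) (r : nat) :=
  exists t : seq R, [/\ uniq t, size t = r & msupport mu = [set x | x \in t]].

Definition cp_decomp (R : realType) (d r : nat) (A : tensor R d)
    (v : 'I_r -> 'cV[R]_2) :=
  (forall i k, 0 <= v i k 0) /\ A = (fun idx => \sum_(i < r) @tpow R d (v i) idx).

Definition cp_rank_is (R : realType) (d : nat) (A : tensor R d) (r : nat) :=
  (exists v : 'I_r -> 'cV[R]_2, cp_decomp A v) /\ forall r' (v : 'I_r' -> 'cV[R]_2), cp_decomp A v -> (r <= r')%N.

Definition gpoly (R : realType) (r : nat) (g : 'rV[R]_r) : {poly R} :=
  \sum_(j < r) (g 0 j)%:P * 'X^j - 'X^r.

(* Main.v *)
Require Import Defs.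
From HB Require Import structures.
From mathcomp Require Import all_boot all_order all_fingroup all_algebra.
From mathcomp Require Import complex.
From mathcomp Require Import all_classical all_reals all_analysis.
From mathcomp Require Import measurable_realfun ring lra zify.
Set Implicit Arguments. Unset Strict Implicit. Unset Printing Implicit Defensive.
Import Order.TTheory GRing.Theory Num.Theory.
Import numFieldNormedType.Exports.
Local Open Scope classical_set_scope.
Local Open Scope ring_scope.

(** The vector [y] defines a functional [L] on polynomials of degree at most
    [2s+1] by [L(X^k) = y_k], and the two semidefiniteness hypotheses say that
    [L(X q^2) >= 0] and [L((1 - X) q^2) >= 0] for [deg q <= s], whence also
    [L(q^2) >= 0].  Take the least [m] for which some monic [p] of degree [m]
    satisfies [L(p^2) = 0] (or, if the form is definite, the orthogonal
    polynomial of degree [m = s+1]).  By Cauchy-Schwarz for the two shifted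
    forms, [L(p q) = 0] whenever [deg (p q) <= 2s+1].  Testing against cofactors
    of [p] shows that [p] has [m] distinct roots, all in [[0, 1]], and Lagrange
    interpolation turns them into a quadrature rule for [L] with positive
    weights, that is, an [m]-atomic representation of [y].

    Everything else is read off this rule.  It factors [H1] through a
    Vandermonde matrix, so [rank H1 = m].  If [y] is represented by [n <= m]
    nodes [t_j] with arbitrary weights, then [L] kills all products of
    [\prod_j (X - t_j)] with polynomials of degree less than [m], so every
    [x_i] is one of the [t_j]; hence [n = m] and the two rules agree up to a
    permutation.  Both measures with finite support and cp-decompositions
    produce such representations: [L_T] maps the power of [(a, b)] to that of
    [(a + b, b)], which is the atom [b / (a + b)] with weight [(a + b)^d]. *)

(** * Polynomials over real closed fields *)

(** Over the algebraic closure [R[i]] there is a root a + ib. If b is nonzero, the remainder of [p]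
    modulo (X - a)^2 + b^2 is real of degree at most 1 and vanishes at a + ib; its imaginary part
    there kills the slope, and then the constant term vanishes too. *)
Lemma real_root_or_quadratic (R : rcfType) (p : {poly R}) : (1 < size p)%N ->
  (exists a, root p a) \/
  (exists a b : R, b != 0 /\ ('X - a%:P) ^+ 2 + (b ^+ 2)%:P %| p).
Proof.
move=> p1; pose f := real_complex R.
have : size (map_poly f p) != 1 by rewrite size_map_poly neq_ltn p1 orbT.
case/closed_rootP=> -[a b] pz.
have [b0|b0] := eqVneq b 0.
  left; exists a; rewrite b0 in pz.
  by rewrite -(fmorph_root f).
right; exists a, b; split=> //.
set q := _ + _.
have sq : size q = 3.
  rewrite size_polyDl ?size_exp_XsubC// size_polyC.
  by case: eqP.
have qz : root (map_poly f q) (a +i* b)%C.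
  rewrite /root /q rmorphD rmorphXn rmorphB /= map_polyX !map_polyC /=.
  rewrite !hornerE; apply/eqP; rewrite /f /real_complex_def; simpc => /=.
  by rewrite expr2 addNr.

rewrite /dvdp; set r := p %% q.
have rz : root (map_poly f r) (a +i* b)%C.
  have := pz; rewrite [in X in X -> _](divp_eq p q) rmorphD rmorphM /root /=.
  by rewrite hornerD hornerM (eqP qz) mulr0 add0r.
have sr : (size r <= 2)%N.
  have q0 : q != 0 by rewrite -size_poly_eq0 sq.
  by have := ltn_modp p q; rewrite q0 sq => /idP.
have Er : r = (r`_1)%:P * 'X + (r`_0)%:P.
  apply/polyP=> -[|[|i]]; rewrite coefD coefMX !coefC ?addr0 ?add0r //=.
  by rewrite nth_default // (leq_trans sr).
move: rz; rewrite Er rmorphD rmorphM /= !map_polyC map_polyX /root !hornerE.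
rewrite /f /real_complex_def; simpc; rewrite eq_complex /= => /andP[].
rewrite mulf_eq0 (negPf b0) orbF => /[swap]/eqP -> /eqP.
by rewrite mul0r add0r => ->; rewrite mul0r addr0.
Qed.

(** Induction on the degree: split off a root a. Quantifying the root hypothesis over all divisors
    lets it pass to the cofactor, and a cannot be a root of the cofactor since (X - a)^2 does not
    divide [p]. *)
Lemma split_distinct (R : fieldType) (p : {poly R}) : p != 0 ->
  (forall q, q %| p -> (1 < size q)%N -> exists a, root q a) ->
  (forall a, ~~ (('X - a%:P) ^+ 2 %| p)) ->
  exists2 rs : seq R, uniq rs & p %= \prod_(a <- rs) ('X - a%:P).
Proof.
have [n] := ubnP (size p); elim: n p => // n IHn p /ltnSE-len p0 hroot hsq.
have [p1|p1] := leqP (size p) 1.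
  exists [::]; rewrite // big_nil -size_poly_eq1 eqn_leq p1.
  by rewrite size_poly_gt0.
have [a pa] := hroot p (dvdpp p) p1.
have /factor_theorem[q pE] := pa.
have qp : q %| p by rewrite pE dvdp_mulr.
have q0 : q != 0 by apply: contraNneq p0 => q0; rewrite pE q0 mul0r.
have [||b|rs urs qE] := IHn q _ q0.
- by rewrite (leq_trans _ len)// pE size_Mmonic ?monicXsubC// size_XsubC addn2.
- by move=> u uq; apply: hroot; apply: dvdp_trans uq qp.
- by apply: contra (hsq b) => /dvdp_trans; apply.
exists (a :: rs).
  rewrite /= urs andbT; apply: contra (hsq a) => ars.
  have : root q a by rewrite (eqp_root qE) root_prod_XsubC.
  by rewrite root_factor_theorem pE expr2 => /dvdp_mul; apply.
by rewrite pE big_cons mulrC eqp_mul2l// polyXsubC_eq0.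
Qed.

Lemma lagrange_basis (R : fieldType) (m : nat) (x : 'I_m -> R) (i : 'I_m) :
  injective x ->
  exists2 l : {poly R}, size l = m & forall j, l.[x j] = (j == i)%:R.
Proof.
move=> xi.
pose w := \prod_(j | j != i) ('X - (x j)%:P).
have wE k : w.[x k] = \prod_(j | j != i) (x k - x j).
  by rewrite horner_prod; apply: eq_bigr => j _; rewrite !hornerE.
have wi : w.[x i] != 0.
  rewrite wE prodf_seq_neq0; apply/allP => j _; apply/implyP => ji.
  by rewrite subr_eq0 eq_sym (inj_eq xi).
exists (w.[x i]^-1 *: w) => [|j].
  rewrite size_scale ?invr_eq0// /w -big_filter size_prod_XsubC.
  rewrite size_filter -sum1_count sum1_card (cardC1 i) card_ord prednK//.
  exact: leq_ltn_trans (leq0n i) _.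
rewrite hornerZ; have [->|ji] := eqVneq j i; first by rewrite mulVf.
by rewrite (wE j) (bigD1 j)//= subrr mul0r mulr0.
Qed.

(** The difference of the two sides has [m] distinct roots and size at most [m]. *)
Lemma lagrange_interpolation (R : fieldType) (m : nat) (x : 'I_m -> R)
    (l : 'I_m -> {poly R}) (q : {poly R}) :
  injective x -> (size q <= m)%N ->
  (forall i, size (l i) = m) -> (forall i j, (l i).[x j] = (j == i)%:R) ->
  q = \sum_i q.[x i] *: l i.
Proof.
move=> xi sq sl lE; apply/eqP; rewrite -subr_eq0; apply/eqP.
apply: (@roots_geq_poly_eq0 _ _ (codom x)).
- apply/allP => _ /codomP[j ->]; rewrite /root hornerD hornerN horner_sum.
  rewrite (bigD1 j)//= big1 => [|i ij]; rewrite hornerZ lE ?eqxx ?mulr1 ?addr0 ?subrr//.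
  by rewrite eq_sym (negPf ij) mulr0.
- by rewrite map_inj_uniq ?enum_uniq.
rewrite size_codom card_ord (leq_trans (size_polyD _ _))// geq_max sq size_polyN.
apply: (leq_trans (size_sum _ _ _)); apply/bigmax_leqP => i _.
by rewrite (leq_trans (size_scale_leq _ _))// sl.
Qed.

(** * Gauss quadrature *)

(** This is L of the overview. It reads as many values of [y] as [p] has coefficients, so linearity
    holds without degree bounds; these enter only where positivity or a quadrature rule is used. *)
Definition riesz (R : nzRingType) (y : nat -> R) (p : {poly R}) : R :=
  \sum_(i < size p) p`_i * y i.

Lemma riesz_wide (R : nzRingType) (y : nat -> R) n (p : {poly R}) :
  (size p <= n)%N -> riesz y p = \sum_(i < n) p`_i * y i.
Proof.
move=> sp; rewrite /riesz (big_ord_widen _ (fun i => p`_i * y i) sp) big_mkcond.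
by apply: eq_bigr => i _; case: ltnP => // pi; rewrite nth_default ?mul0r.
Qed.

Lemma riesz_is_linear (R : nzRingType) (y : nat -> R) : scalar (riesz y).
Proof.
move=> a p q; pose n := maxn (size p) (size q).
have sa : (size (a *: p) <= n)%N.
  by rewrite (leq_trans (size_scale_leq _ _))// leq_maxl.
rewrite (@riesz_wide _ _ n) ?(leq_trans (size_polyD _ _)) ?geq_max ?sa ?leq_maxr//.
rewrite (@riesz_wide _ _ n p) ?leq_maxl// (@riesz_wide _ _ n q) ?leq_maxr//.
rewrite mulr_sumr -big_split; apply: eq_bigr => i _ /=.
by rewrite coefD coefZ mulrDl mulrA.
Qed.

HB.instance Definition _ (R : nzRingType) (y : nat -> R) :=
  GRing.isLinear.Build R {poly R} R *%R (riesz y) (@riesz_is_linear R y).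

Lemma rieszXn (R : nzRingType) (y : nat -> R) k : riesz y 'X^k = y k.
Proof.
rewrite (@riesz_wide _ _ k.+1) ?size_polyXn// big_ord_recr/= coefXn eqxx mul1r.
rewrite big1 ?add0r// => i _; rewrite coefXn lt_eqF ?mul0r//.
exact: ltn_ord i.
Qed.

Lemma riesz_mul (R : rcfType) (y : nat -> R) n (w q : {poly R}) :
  (size q <= n)%N ->
  riesz y (w * q) = \sum_(i < n) q`_i * riesz y (w * 'X^i).
Proof.
move=> sq; have -> : q = \sum_(i < n) q`_i *: 'X^i.
  rewrite -poly_def; apply/polyP => i; rewrite coef_poly.
  by case: ltnP => // /(leq_trans sq) qi; rewrite nth_default.
rewrite mulr_sumr linear_sum; apply: eq_bigr => i _ /=.
rewrite -scalerAr linearZ/= -poly_def coef_poly ltn_ord.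
by [].
Qed.

Section GaussQuadrature.
Variables (R : rcfType) (y : nat -> R) (s : nat).
Local Notation L := (riesz y).
Hypothesis posX : forall q : {poly R}, (size q <= s.+1)%N -> 0 <= L ('X * q ^+ 2).
Hypothesis pos1X : forall q : {poly R},
  (size q <= s.+1)%N -> 0 <= L ((1 - 'X) * q ^+ 2).

Lemma riesz_sqr (q : {poly R}) :
  L (q ^+ 2) = L ('X * q ^+ 2) + L ((1 - 'X) * q ^+ 2).
Proof. by rewrite -linearD /=; congr riesz; ring. Qed.

Lemma riesz_sqr_ge0 (q : {poly R}) : (size q <= s.+1)%N -> 0 <= L (q ^+ 2).
Proof. by move=> sq; rewrite riesz_sqr addr_ge0 ?posX ?pos1X. Qed.

(** When the form vanishes at [p], its value at t p + q is affine in t with slope 2 L(w p q); a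
    nonzero slope would make it negative somewhere. *)
Lemma riesz_cauchy_schwarz0 n (w p q : {poly R}) :
  (forall u : {poly R}, (size u <= n)%N -> 0 <= L (w * u ^+ 2)) ->
  (size p <= n)%N -> (size q <= n)%N ->
  L (w * p ^+ 2) = 0 -> L (w * (p * q)) = 0.
Proof.
move=> wpos sp sq wp; apply/eqP/negPn/negP => b0.
set b := L _ in b0; pose c := L (w * q ^+ 2).
(* Chosen so that 2 t b + c = -1. *)
pose t := - (c + 1) / (2 * b).
have := wpos (t *: p + q).
rewrite (leq_trans (size_polyD _ _)) => [/(_ isT)|]; last first.
  by rewrite geq_max sq (leq_trans (size_scale_leq _ _)).
have -> : w * (t *: p + q) ^+ 2 =
    (t ^+ 2) *: (w * p ^+ 2) + ((2 * t) *: (w * (p * q)) + w * q ^+ 2).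
  rewrite -!mul_polyC !rmorphXn /= !rmorphM /= [(2%:R)%:P]rmorph_nat; ring.
rewrite !linearD !linearZ /= wp mulr0 add0r -/b -/c.
suff -> : 2 * t * b + c = -1 by rewrite oppr_ge0 ler10.
rewrite /t; field; exact: b0.
Qed.

(** L(p^2) is the sum of the two shifted forms at [p], both nonnegative, so both vanish.
    Cauchy-Schwarz applies to each, and adding the results gives L(p q) = 0. *)
Lemma riesz_null (p q : {poly R}) : (size p <= s.+1)%N -> (size q <= s.+1)%N ->
  L (p ^+ 2) = 0 -> L (p * q) = 0 /\ L ('X * (p * q)) = 0.
Proof.
move=> sp sq Lp.
have /andP[] : (L ('X * p ^+ 2) == 0) && (L ((1 - 'X) * p ^+ 2) == 0).
  by rewrite -paddr_eq0 ?posX ?pos1X// -riesz_sqr Lp.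
move=> /eqP /(riesz_cauchy_schwarz0 posX sp sq) LX.
move=> /eqP /(riesz_cauchy_schwarz0 pos1X sp sq) L1X; split=> //.
by rewrite -[RHS]addr0 -{1}LX -L1X -linearD /=; congr riesz; ring.
Qed.

(** Null polynomials stay null under multiplication by X while the degree is at most [s]: the second
    identity for X^k p, tested on q = X^(k+1) p, reads L((X^(k+1) p)^2) = 0. *)
Lemma riesz_null_shift (p : {poly R}) k (q : {poly R}) :
  (size p + k <= s.+1)%N -> (size q <= s.+1)%N ->
  L (p ^+ 2) = 0 -> L ('X^k * p * q) = 0 /\ L ('X * ('X^k * p * q)) = 0.
Proof.
move=> + + Lp; elim: k q => [|k IHk] q spk sq.
  have sp : (size p <= s.+1)%N by rewrite (leq_trans _ spk)// leq_addr.
  by have := riesz_null sp sq Lp; rewrite mul1r.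
have sk : (size ('X^(k.+1) * p : {poly R})%R <= s.+1)%N.
  by rewrite (leq_trans (size_polyMleq _ _))// size_polyXn addSn/= addnC.
have [_] := IHk _ ltac:(lia) sk.
by rewrite !mulrA -exprS -mulrA -expr2 => /(riesz_null sk sq); rewrite !mulrA.
Qed.

(** The bound on [size q] means deg(p q) <= 2s+1. For m = s+1 this is the usual orthogonality to
    degrees below [m]; for smaller [m] it asks for more. *)
Definition orthogonal_polynomial m (p : {poly R}) :=
  [/\ (m <= s.+1)%N, p \is monic, size p = m.+1,
    forall q : {poly R}, (size q + m <= s.*2.+2)%N -> L (p * q) = 0 &
    forall q : {poly R}, q != 0 -> (size q <= m)%N -> 0 < L (q ^+ 2)].

Lemma ex_orthogonal_polynomial : exists m p, orthogonal_polynomial m p.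
Proof.
pose P n := `[< exists p, [/\ (n <= s)%N, p \is monic, size p = n.+1
   & L (p ^+ 2) = 0] >].
(* Below the least degree of a null polynomial the form is definite, since a nonzero null polynomial
   can be made monic. *)
have pos m (q : {poly R}) : (m <= s.+1)%N -> (forall n, P n -> (m <= n)%N) ->
    q != 0 -> (size q <= m)%N -> 0 < L (q ^+ 2).
  move=> ms Pm q0 sq; rewrite lt_neqAle riesz_sqr_ge0 ?(leq_trans sq)// andbT.
  apply/eqP => Lq0; have := Pm (size q).-1; rewrite leqNgt.
  have sq0 : (0 < size q)%N by rewrite size_poly_gt0.
  rewrite prednK// sq => H; suff /H : P (size q).-1 by [].
  apply/asboolP; exists ((lead_coef q)^-1 *: q); split.
  - by rewrite -ltnS prednK// (leq_trans sq).
  - by rewrite monicE lead_coefZ mulVf// lead_coef_eq0.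
  - by rewrite size_scale ?invr_eq0 ?lead_coef_eq0// prednK.
  - by rewrite exprZn linearZ/= -Lq0 mulr0.
have [exP|nP] := pselect (exists n, P n).
  exists (ex_minn exP); case: ex_minnP => m /asboolP[p [ms pm sp Lp]] min.
  exists p; split=> // [|q sq|q]; [exact: leqW| |exact: pos (leqW ms) min].
  suff LX i : (i < s.*2.+2 - m)%N -> L (p * 'X^i) = 0.
    rewrite (@riesz_mul _ _ (s.*2.+2 - m)); last by lia.
    by rewrite big1// => i _; rewrite LX ?mulr0.
  have [is_|is_] := leqP i s => im.
    have := @riesz_null_shift p 0 'X^i; rewrite addn0 sp size_polyXn mul1r.
    by move=> /(_ ms is_ Lp)[].
  (* For i > s, split X^i as X times X^(i-s-1) times X^s: the middle factor is the shift, X^s is the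
     test polynomial, and the extra X comes from the second identity. *)
  have := @riesz_null_shift p (i - s.+1) 'X^s; rewrite sp size_polyXn.
  move=> /(_ ltac:(lia) (leqnn _) Lp)[_ E]; rewrite -[RHS]E; congr riesz.
  have Ei : ((i - s.+1).+1 + s)%N = i by lia.
  by rewrite !mulrA -exprS mulrAC -exprD Ei mulrC.
have pos1 (q : {poly R}) : q != 0 -> (size q <= s.+1)%N -> 0 < L (q ^+ 2).
  by apply: pos => // n Pn; case: nP; exists n.
(* Definite case: the Gram matrix of the monomials is invertible, because u H = 0 forces L(u^2) =
   0. *)
pose H : 'M[R]_s.+1 := \matrix_(i, j) y (i + j)%N.
have HE (u : 'rV[R]_s.+1) (j : 'I_s.+1) : (u *m H) 0 j = L ('X^j * rVpoly u).
  rewrite (@riesz_mul _ _ s.+1) ?size_poly// mxE; apply: eq_bigr => i _.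
  by rewrite coef_rVpoly_ord mxE -exprD rieszXn addnC.
have Hunit : H \in unitmx.
  rewrite -row_free_unit; apply/inj_row_free => u uH.
  apply: (can_inj rVpolyK); rewrite linear0; apply/eqP/negPn/negP => u0.
  have := pos1 _ u0 (size_poly _ _); rewrite expr2 (@riesz_mul _ _ s.+1) ?size_poly//.
  rewrite big1 ?ltxx// => i _.
  by rewrite [X in L X]mulrC -HE uH mxE mulr0.
(* The normal equations: [c] is the projection of X^(s+1) on the polynomials of degree at most
   [s]. *)
pose c := (\row_(j < s.+1) y (s.+1 + j)%N) *m invmx H.
exists s.+1, ('X^(s.+1) - rVpoly c).
have sc : (size (rVpoly c) < size ('X^(s.+1) : {poly R}))%N.
  by rewrite size_polyXn ltnS size_poly.
split=> //.
- by rewrite monicE lead_coefDl ?size_polyN// lead_coefXn.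
- by rewrite size_polyDl ?size_polyN// size_polyXn.
move=> q sq; rewrite (@riesz_mul _ _ s.+1); last by lia.
rewrite big1// => i _; rewrite mulrBl linearB/= -exprD rieszXn.
by rewrite [_ * 'X^i]mulrC -HE /c mulmxKV// mxE subrr mulr0.
Qed.

(* If [p = u f] with [f] a sum of squares of degree 2, then [L(p u) > 0] although
   [deg u < m]; this excludes non-real and double roots.  For [f = X - a],
   [L(p u) = 0] says that [a] is the ratio [L(X u^2) / L(u^2)]. *)
Lemma orthogonal_polynomial_roots m p : orthogonal_polynomial m p ->
  exists x : 'I_m -> R, [/\ injective x, forall i, 0 <= x i <= 1 &
    forall i, root p (x i)].
Proof.
move=> [ms pm sp orth pos].
have p0 : p != 0 by rewrite -size_poly_gt0 sp.
have orth' (q : {poly R}) : (size q <= m)%N -> L (p * q) = 0.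
  by move=> sq; apply: orth; lia.
have cofactor (q u : {poly R}) k : p = u * q -> size q = k.+2 ->
    [/\ u != 0, (size u + k.+1 = m.+1)%N & (size u <= m)%N].
  move=> pE sq; have u0 : u != 0 by apply: contraNneq p0 => u0; rewrite pE u0 mul0r.
  suff su : (size u + k.+1 = m.+1)%N
    by split=> //; rewrite -ltnS -su addnS ltnS leq_addr.
  by rewrite -sp pE size_mul// ?sq ?addnS// -size_poly_eq0 sq.
(* Here (X - a) u has degree m - 1, still in the range where the form is definite. *)
have factor_pos (u : {poly R}) a : u != 0 -> (size u + 2 = m.+1)%N ->
    0 < L ((('X - a%:P) * u) ^+ 2).
  move=> u0 su; apply: pos; first by rewrite mulf_neq0 ?polyXsubC_eq0.
  by rewrite size_monicM ?monicXsubC// size_XsubC; lia.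
have [||rs urs prs] := split_distinct p0.
- move=> q qp /real_root_or_quadratic[//|[a [b [b0 /dvdp_trans/(_ qp)]]]].
  move=> /dvdpP[u pE]; exfalso.
  have [|u0 su su'] := cofactor _ _ 1 pE.
    by rewrite size_polyDl ?size_exp_XsubC// size_polyC; case: eqP.
  have := orth' u su'; rewrite pE.
  have -> : u * (('X - a%:P) ^+ 2 + (b ^+ 2)%:P) * u =
     (('X - a%:P) * u) ^+ 2 + (b ^+ 2) *: u ^+ 2 by rewrite -mul_polyC; ring.
  rewrite linearD linearZ /= => /eqP; apply/negP.
  rewrite gt_eqF// ltr_pwDl ?factor_pos// mulr_ge0 ?sqr_ge0//.
  by rewrite ltW// pos.
- move=> a; apply/negP => /dvdpP[u pE].
  have [|u0 su su'] := cofactor _ _ 1 pE; first by rewrite size_exp_XsubC.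
  have := orth' u su'; rewrite pE.
  have -> : u * ('X - a%:P) ^+ 2 * u = (('X - a%:P) * u) ^+ 2 by ring.
  by move=> /eqP; rewrite gt_eqF// factor_pos.
have {}prs : p = \prod_(a <- rs) ('X - a%:P).
  by apply/eqP; rewrite -eqp_monic// monic_prod_XsubC.
have srs : size rs = m by have := sp; rewrite prs size_prod_XsubC => -[].
have rp (i : 'I_m) : root p rs`_i.
  by rewrite prs root_prod_XsubC mem_nth ?srs.
exists (fun i => rs`_i); split=> //.
  move=> i j ij; apply/val_inj/eqP; rewrite /= -(nth_uniq 0 _ _ urs) ?srs//.
  exact/eqP.
move=> i; set a := rs`_i; have /factor_theorem[u pE] := rp i.
have [|u0 su su'] := cofactor _ _ 0 pE; first by rewrite size_XsubC.
have Lu : 0 < L (u ^+ 2) by apply: pos.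
have := orth' u su'; rewrite pE => Lp.
have sus := leq_trans su' ms.
(* As L(p u) = 0, the two shifted forms take the values a L(u^2) and (1 - a) L(u^2) at [u]. *)
have E1 : 'X * u ^+ 2 = u * ('X - a%:P) * u + a *: u ^+ 2.
  by rewrite -mul_polyC; ring.
have E2 : (1 - 'X) * u ^+ 2 = (1 - a) *: u ^+ 2 - u * ('X - a%:P) * u.
  by rewrite -mul_polyC rmorphB rmorph1 /=; ring.
have := posX sus; have := pos1X sus; rewrite E1 E2 linearB linearD !linearZ/= Lp.
by rewrite subr0 add0r !pmulr_lge0// subr_ge0 => -> ->.
Qed.

Lemma gauss_quadrature : exists m (x lam : 'I_m -> R),
  [/\ (m <= s.+1)%N, injective x, forall i, 0 <= x i <= 1, forall i, 0 < lam i &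
    forall k, (k <= s.*2.+1)%N -> y k = \sum_i lam i * x i ^+ k].
Proof.
have [m [p op]] := ex_orthogonal_polynomial.
have [x [xi x01 rx]] := orthogonal_polynomial_roots op.
have [ms pm sp orth pos] := op.
pose l i := sval (cid2 (lagrange_basis i xi)).
have sl i : size (l i) = m by rewrite /l; case: cid2.
have lE i j : (l i).[x j] = (j == i)%:R by rewrite /l; case: cid2.
(* Divide by [p]: orthogonality kills the quotient term, and the remainder is interpolated at the
   nodes, where it agrees with [q]. *)
have quad (q : {poly R}) : (size q <= s.*2.+2)%N -> L q = \sum_i L (l i) * q.[x i].
  move=> sq; rewrite {1}(divp_eq q p) linearD/= mulrC orth ?add0r; last first.
    rewrite size_divp -?size_poly_gt0 sp//= addnC -maxnE geq_max sq andbT; lia.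
  rewrite (lagrange_interpolation (q := q %% p) xi _ sl lE); last first.
    by rewrite -ltnS -sp ltn_modp -size_poly_gt0 sp.
  rewrite linear_sum; apply: eq_bigr => i _; rewrite linearZ /= mulrC.
  rewrite [in RHS](divp_eq q p) hornerD hornerM.
  by have /rootP -> := rx i; rewrite mulr0 add0r.
exists m, x, (fun i => L (l i)); split=> // [i|k km].
  have m0 : (0 < m)%N by rewrite (leq_ltn_trans _ (ltn_ord i)).
  have l0 : l i != 0 by rewrite -size_poly_gt0 sl.
  (* The rule is exact on the square of [l i], so the weight L(l_i) equals L(l_i^2) > 0. *)
  have := pos _ l0; rewrite sl leqnn => /(_ isT).
  rewrite quad; last by rewrite expr2 (leq_trans (size_polyMleq _ _))// sl; lia.
  rewrite (bigD1 i)//= big1 ?addr0 => [|j ji];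
    rewrite hornerE lE ?eqxx ?expr1n ?mulr1//.
  by rewrite (negPf ji) expr0n mulr0.
rewrite -(rieszXn y k) quad ?size_polyXn; last by lia.
by apply: eq_bigr => i _; rewrite hornerXn.
Qed.

End GaussQuadrature.

(** * Uniqueness of short representations *)

(** Nodes may coincide and weights may have any sign or vanish, so that arbitrary cp-decompositions
    are covered. *)
Definition atomic_moments (R : nzRingType) (y : nat -> R) d n (t mu : 'I_n -> R) :=
  forall k, (k <= d)%N -> y k = \sum_i mu i * t i ^+ k.

Lemma riesz_atomic (R : rcfType) (y : nat -> R) d n (t mu : 'I_n -> R) (q : {poly R}) :
  atomic_moments y d t mu -> (size q <= d.+1)%N ->
  riesz y q = \sum_i mu i * q.[t i].
Proof.
move=> ymu sq; rewrite (riesz_wide _ sq).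
under eq_bigr => k _ do rewrite ymu -1?ltnS// mulr_sumr.
rewrite exchange_big; apply: eq_bigr => i _ /=.
rewrite (horner_coef_wide _ sq) mulr_sumr; apply: eq_bigr => k _.
by rewrite mulrCA.
Qed.

Section AtomicMoments.
Variables (R : rcfType) (y : nat -> R) (s m : nat) (x lam : 'I_m -> R).
Hypothesis ms : (m <= s.+1)%N.
Hypothesis xi : injective x.
Hypothesis lam0 : forall i, lam i != 0.
Hypothesis ylam : atomic_moments y s.*2.+1 x lam.
Local Notation L := (riesz y).

Let p : {poly R} := \prod_i ('X - (x i)%:P).

(** Testing [h] against the Lagrange polynomial of node i gives lam_i h(x_i) = 0. *)
Lemma riesz_node (h : {poly R}) i : (size h + m <= s.*2.+3)%N ->
  (forall k, (k < m)%N -> L (h * 'X^k) = 0) -> h.[x i] = 0.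
Proof.
move=> sh Lh; have [l sl lE] := lagrange_basis i xi.
have : L (h * l) = 0.
  by rewrite (@riesz_mul _ _ m) ?sl// big1// => k _; rewrite Lh ?mulr0.
rewrite (riesz_atomic ylam); last first.
  by rewrite (leq_trans (size_polyMleq _ _))// sl -subn1 leq_subLR.
rewrite (bigD1 i)//= big1 ?addr0 => [|j ji]; rewrite hornerM lE ?eqxx ?mulr1.
  by move/eqP; rewrite mulf_eq0 (negPf (lam0 i)) => /eqP.
by rewrite (negPf ji) !mulr0.
Qed.

Lemma node_root i : root p (x i).
Proof. by rewrite /root horner_prod (bigD1 i)//= !hornerE subrr mul0r. Qed.

Lemma monic_node_poly : p \is monic.
Proof. exact: monic_prod_XsubC. Qed.

Lemma size_node_poly : size p = m.+1.
Proof. by rewrite /p -big_enum size_prod_XsubC size_enum_ord. Qed.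

Lemma roots_nodes n (h : {poly R}) : size h = n.+1 ->
  (forall i, root h (x i)) -> (m <= n)%N.
Proof.
move=> sh rh; rewrite -ltnS -sh -[X in (X < _)%N]card_ord -(size_codom x).
apply: max_poly_roots; first by rewrite -size_poly_gt0 sh.
  by apply/allP => _ /codomP[i ->].
by rewrite map_inj_uniq ?enum_uniq.
Qed.

Lemma eq_node_poly (h : {poly R}) : h \is monic -> size h = m.+1 ->
  (forall i, root h (x i)) -> h = p.
Proof.
move=> mh sh rh; have ph : p %| h.
  rewrite /p -big_enum -(big_map x xpredT (fun a => 'X - a%:P)).
  apply: uniq_roots_dvdp; first by apply/allP => _ /mapP[i _ ->].
  by rewrite uniq_rootsE map_inj_uniq ?enum_uniq.
apply/esym/eqP; rewrite -eqp_monic ?monic_node_poly// -dvdp_size_eqp//.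
by rewrite sh size_node_poly.
Qed.

(** The orthogonality relations force every node to be a root of [h], which pins down a monic
    polynomial of degree [m]; this is the source of uniqueness in the linear system. *)
Lemma node_poly_orthogonal (h : {poly R}) : h \is monic -> size h = m.+1 ->
  (forall k, (k <= s.*2.+1 - m)%N -> L (h * 'X^k) = 0) <-> h = p.
Proof.
move=> mh sh; split=> [Lh|-> k km].
  apply: eq_node_poly => // i; apply/rootP/riesz_node; first by rewrite sh; lia.
  by move=> k km; apply: Lh; lia.
rewrite (riesz_atomic ylam) => [|].
  rewrite big1// => i _.
  by rewrite hornerM (rootP (node_root i)) mul0r mulr0.
rewrite (leq_trans (size_polyMleq _ _))// size_node_poly size_polyXn; lia.
Qed.

Lemma atomic_moments_unique n (t mu : 'I_n -> R) :
  atomic_moments y s.*2.+1 t mu ->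
  (m <= n)%N /\ forall e : n = m, exists f : 'I_n -> 'I_m,
    [/\ injective f, forall i, t i = x (f i) & forall i, mu i = lam (f i)].
Proof.
move=> ymu; pose w : {poly R} := \prod_j ('X - (t j)%:P).
have sw : size w = n.+1 by rewrite /w -big_enum size_prod_XsubC size_enum_ord.
have wt j : w.[t j] = 0 by rewrite horner_prod (bigD1 j)//= !hornerE subrr mul0r.
(* With n <= m <= s+1 and k < m, the product w X^k has degree at most 2s+1, so L can be evaluated by
   the second rule. *)
have wx i : (n <= m)%N -> root w (x i).
  move=> nm; apply/rootP/riesz_node; first by rewrite sw; lia.
  move=> k km; rewrite (riesz_atomic ymu).
    by rewrite big1// => j _; rewrite hornerM wt mul0r mulr0.
  rewrite (leq_trans (size_polyMleq _ _))// sw size_polyXn; lia.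
split=> [|e].
  by have [/wx rw|/ltnW//] := leqP n m; apply: roots_nodes sw _ => i; apply: rw.
subst n; have g_ex i : exists j, t j = x i.
  have : root w (x i) by exact: wx.
  rewrite /w -big_enum -(big_map t xpredT (fun a => 'X - a%:P)).
  by rewrite root_prod_XsubC => /mapP[j _ ->]; exists j.
pose g i := projT1 (cid (g_ex i)).
have gE i : t (g i) = x i by rewrite /g; case: cid.
have gi : injective g by move=> i j /(congr1 t); rewrite !gE => /xi.
(* An injective self-map of a finite type is invertible. *)
exists (invF gi); split=> [||j]; first exact: can_inj (f_invF gi).
  by move=> j; rewrite -gE f_invF.
set i := invF gi j; have -> : j = g i by rewrite f_invF.
(* Evaluating L at the Lagrange polynomial of node i by both rules compares the two weights. *)
have [l sl lE] := lagrange_basis i xi.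
have sl' : (size l <= s.*2.+2)%N by rewrite sl; lia.
have := riesz_atomic ymu sl'; rewrite (riesz_atomic ylam sl').
rewrite (bigD1 i)//= lE eqxx mulr1 big1 ?addr0 => [|k ki]; last first.
  by rewrite lE (negPf ki) mulr0.
rewrite (reindex_inj gi) (bigD1 i)//= gE lE eqxx mulr1 big1 ?addr0 => [-> //|k ki].
by rewrite gE lE (negPf ki) mulr0.
Qed.

(** H = V D V^T bounds the rank above by [m]. The coefficients of the Lagrange polynomials form a
    left inverse E of V, so E H E^T = D is invertible and bounds it below. *)
Lemma rank_hankel : \rank (\matrix_(i < s.+1, j < s.+1) y (i + j)%N) = m.
Proof.
pose V : 'M[R]_(s.+1, m) := \matrix_(i, j) x j ^+ i.
pose D : 'M[R]_m := diag_mx (\row_j lam j).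
pose l i : {poly R} := s2val (cid2 (lagrange_basis i xi)).
have sl i : size (l i) = m by rewrite /l; case: cid2.
have lE i j : (l i).[x j] = (j == i)%:R by rewrite /l; case: cid2.
pose E : 'M[R]_(m, s.+1) := \matrix_(i, j) (l i)`_j.
have EV : E *m V = 1%:M.
  apply/matrixP => i j; rewrite !mxE eq_sym -lE (@horner_coef_wide _ s.+1) ?sl//.
  by apply: eq_bigr => k _; rewrite !mxE.
set H := matrix_of_fun _ _.
have HE : H = V *m D *m V^T.
  apply/matrixP => i j; rewrite !mxE ylam; last first.
    by have := ltn_ord i; have := ltn_ord j; lia.
  apply: eq_bigr => k _; rewrite mul_mx_diag !mxE exprD mulrA; congr (_ * _).
  exact: mulrC.
apply/eqP; rewrite eqn_leq; apply/andP; split.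
  by rewrite HE -mulmxA (leq_trans (mulmx_max_rank _ _)).
have -> : m = \rank (E *m H *m E^T).
  rewrite HE !mulmxA EV mul1mx -mulmxA -trmx_mul EV trmx1 mulmx1.
  rewrite mxrank_unit// unitmxE det_diag unitfE prodf_seq_neq0.
  by apply/allP => i _; rewrite mxE lam0.
by rewrite (leq_trans (mxrankM_maxl _ _))// mxrankM_maxr.
Qed.

End AtomicMoments.

(** * Symmetric tensors *)

Lemma sum_tuple_prod (R : comNzRingType) (I : finType) d (F : 'I_d -> I -> R) :
  \sum_(j : d.-tuple I) \prod_(k < d) F k (tnth j k) = \prod_(k < d) \sum_a F k a.
Proof.
rewrite bigA_distr_bigA (reindex (fun f : {ffun 'I_d -> I} => [tuple f k | k < d])).
  by apply: eq_bigr => f _; apply: eq_bigr => k _; rewrite tnth_mktuple.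
exists (fun t : d.-tuple I => [ffun k => tnth t k]) => [f _|t _].
  by apply/ffunP => k; rewrite ffunE tnth_mktuple.
by apply: eq_from_tnth => k; rewrite tnth_mktuple ffunE.
Qed.

Section Tensors.
Variables (R : realType) (d : nat).
Implicit Types (X Y A : tensor R d) (S T : 'M[R]_2) (v : 'cV[R]_2).

Definition tuple_perm (p : {perm 'I_d}) (i : d.-tuple 'I_2) : d.-tuple 'I_2 :=
  [tuple tnth i (p j) | j < d].

Lemma tuple_perm_bij p : bijective (tuple_perm p).
Proof.
by exists (tuple_perm p^-1%g) => t; apply: eq_from_tnth => k;
  rewrite !tnth_mktuple (permK, permKV).
Qed.

(** Together with [LT_id], this makes [LT] of an invertible matrix invertible. *)
Lemma LT_mul S T X : LT S (LT T X) = LT (S *m T) X.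
Proof.
apply/funext => i; rewrite /LT.
under eq_bigr => j _ do rewrite mulr_sumr.
rewrite exchange_big; apply: eq_bigr => l _ /=.
under eq_bigr => j _ do rewrite mulrA -big_split.
rewrite -mulr_suml; congr (_ * _).
rewrite (sum_tuple_prod (fun k a => S (tnth i k) a * T a (tnth l k))).
by apply: eq_bigr => k _; rewrite mxE.
Qed.

Lemma LT_id X : LT 1%:M X = X.
Proof.
apply/funext => i; rewrite /LT (bigD1 i)//= [X in X * _]big1 => [|k _]; last first.
  by rewrite mxE eqxx.
rewrite mul1r big1 ?addr0// => j ji.
have [k ik] : exists k, tnth i k != tnth j k.
  apply/existsP; apply: contraNT ji => /existsPn ij; apply/eqP.
  by apply: eq_from_tnth => k; apply/eqP; rewrite eq_sym -[_ == _]negbK ij.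
by rewrite (bigD1 k)//= mxE (negPf ik) !mul0r.
Qed.

Lemma LT_tpow T v : LT T (@tpow R d v) = @tpow R d (T *m v).
Proof.
apply/funext => i; rewrite /LT /tpow.
under eq_bigr => j _ do rewrite -big_split.
rewrite (sum_tuple_prod (fun k a => T (tnth i k) a * v a 0)).
by apply: eq_bigr => k _; rewrite mxE.
Qed.

Lemma LT_sum T n (F : 'I_n -> tensor R d) :
  LT T (fun i => \sum_(j < n) F j i) = (fun i => \sum_(j < n) LT T (F j) i).
Proof.
apply/funext => i; rewrite /LT exchange_big /=.
by apply: eq_bigr => k _; rewrite mulr_sumr.
Qed.

Lemma symmetric_LT T X : symmetric_tensor X -> symmetric_tensor (LT T X).
Proof.
move=> symX i p; rewrite /LT (reindex (tuple_perm p)); last first.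
  exact: onW_bij (tuple_perm_bij p).
apply: eq_bigr => j _; rewrite symX; congr (_ * _).
rewrite [RHS](reindex_inj (@perm_inj _ p)); apply: eq_bigr => k _.
by rewrite !tnth_mktuple.
Qed.

Lemma symmetric_sum_tpow n (v : 'I_n -> 'cV[R]_2) :
  symmetric_tensor (fun i => \sum_(j < n) @tpow R d (v j) i).
Proof.
move=> i p; apply: eq_bigr => j _.
rewrite /tpow [RHS](reindex_inj (@perm_inj _ p)); apply: eq_bigr => k _.
by rewrite !tnth_mktuple.
Qed.

Lemma prod_bidx n (f : 'I_2 -> R) : (n <= d)%N ->
  \prod_(k < d) f (tnth (bidx d n) k) = f 0 ^+ (d - n) * f 1 ^+ n.
Proof.
move=> nd; under eq_bigr => k _ do rewrite tnth_mktuple (fun_if f).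
rewrite -(big_mkord xpredT (fun k => if (d - n <= k)%N then f 1 else f 0)).
rewrite (@big_cat_nat _ _ _ (d - n)) ?leq_subr//=; congr (_ * _).
  rewrite big_nat (eq_bigr (fun=> f 0)) => [|k /andP[_ kn]]; last by rewrite leqNgt kn.
  by rewrite -big_nat prodr_const_nat subn0.
rewrite big_nat (eq_bigr (fun=> f 1)) => [|k /andP[-> _]//].
by rewrite -big_nat prodr_const_nat subKn.
Qed.

Lemma val_bidx n : (n <= d)%N ->
  bidx d n = nseq (d - n) 0 ++ nseq n 1 :> seq 'I_2.
Proof.
move=> nd; apply: (@eq_from_nth _ 0) => [|k].
  by rewrite size_tuple size_cat !size_nseq subnK.
rewrite size_tuple => kd; rewrite nth_cat size_nseq.
rewrite -[k]/(val (Ordinal kd)) -tnth_nth tnth_mktuple/= !nth_nseq.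
case: ltnP => //= dk; case: ltnP => //; lia.
Qed.

(** Up to permutation, an index tuple is determined by its number of ones. *)
Lemma symmetric_Bvec_inj X Y : symmetric_tensor X -> symmetric_tensor Y ->
  (forall k, (k <= d)%N -> Bvec X k = Bvec Y k) -> X = Y.
Proof.
move=> symX symY XY; apply/funext => i.
pose n := count_mem (1 : 'I_2) i.
have nd : (n <= d)%N by rewrite -[X in (_ <= X)%N](size_tuple i) count_size.
have i0 : count_mem (0 : 'I_2) i = (d - n)%N.
  rewrite -[X in (X - _)%N](size_tuple i) -(count_predC (pred1 (0 : 'I_2)) i).
  rewrite [X in (_ + X - _)%N](_ : _ = n) ?addnK//.
  by apply: eq_count => -[[|[|[]]]].
have /tuple_permP[p ip] : perm_eq i (bidx d n).
  apply/allP => a _ /=; rewrite val_bidx// count_cat !count_nseq /=.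
  case: (a =P 0) => [->|a0]; first by rewrite i0 /= mul0n addn0 mul1n.
  have -> : a = 1 by case: a a0 => -[|[|[]]]//= ? a0; [case: a0|]; apply: val_inj.
  by rewrite /= mul0n mul1n.
have -> : i = [tuple tnth (bidx d n) (p j) | j < d] by apply: val_inj.
rewrite symX symY; exact: XY.
Qed.

Lemma Bvec_LT_Tmat_sum n (v : 'I_n -> 'cV[R]_2) k : (k <= d)%N ->
  Bvec (LT (Tmat R) (fun i => \sum_(j < n) @tpow R d (v j) i)) k =
  \sum_(j < n) (v j 0 0 + v j 1 0) ^+ (d - k) * v j 1 0 ^+ k.
Proof.
move=> kd; rewrite /Bvec LT_sum; apply: eq_bigr => j _.
rewrite LT_tpow /tpow (prod_bidx (fun a => (Tmat R *m v j) a 0) kd).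
rewrite !mxE !big_ord_recl !big_ord0 !mxE /= mul0r !mul1r !addr0 add0r.
by rewrite (_ : lift ord0 ord0 = 1)//; apply: val_inj.
Qed.

Lemma Tmat_unit : Tmat R \in unitmx.
Proof.
rewrite unitmxE -det_tr det_trig => [|]; last first.
  by apply/is_trig_mxP => i j ij; rewrite !mxE leqNgt ij.
by rewrite big1 ?unitr1// => i _; rewrite !mxE leqnn.
Qed.

(** Both tensors are symmetric and have the same image under the invertible map [LT (Tmat R)]. This
    turns a quadrature rule for the moments into a decomposition of [A]. *)
Lemma sum_tpow_Bvec A n (v : 'I_n -> 'cV[R]_2) : symmetric_tensor A ->
  (forall k, (k <= d)%N -> Bvec (LT (Tmat R) A) k =
     \sum_(j < n) (v j 0 0 + v j 1 0) ^+ (d - k) * v j 1 0 ^+ k) ->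
  A = (fun i => \sum_(j < n) @tpow R d (v j) i).
Proof.
move=> symA yA; set B := (X in _ = X).
have symB : symmetric_tensor B := symmetric_sum_tpow v.
have : LT (Tmat R) A = LT (Tmat R) B.
  apply: symmetric_Bvec_inj; [exact: symmetric_LT|exact: symmetric_LT|].
  by move=> k kd; rewrite yA// Bvec_LT_Tmat_sum.
move/(congr1 (LT (invmx (Tmat R)))).
by rewrite !LT_mul mulVmx ?Tmat_unit// !LT_id.
Qed.

End Tensors.

(** * Measures with finite support *)

Section AtomicMeasures.
Variable R : realType.
Implicit Types mu : {measure set R -> \bar R}.

(** A point off the support has a null neighbourhood, hence lies in a null ball with rational centre
    and radius; there are countably many of these. *)
Lemma negligible_msupportC mu : mu.-negligible (~` msupport mu).
Proof.
have measurable_ball (a e : R) : measurable (ball a e).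
  by rewrite ball_itv; exact: measurable_itv.
pose B (cr : rat * rat) : set R := ball (ratr cr.1 : R) (ratr cr.2).
(* Integers that code no pair, and balls of nonzero mass, contribute the empty set. *)
pose F k : set R := if unpickle k is Some cr then
  if `[< mu (B cr) = 0%E >] then B cr else set0 else set0.
apply: (@negligibleS _ _ _ _ (\bigcup_k F k)); last first.
  apply: negligible_bigcup => k; rewrite /F.
  case: unpickle => [cr|]; last exact: negligible_set0.
  case: asboolP => [B0|_]; last exact: negligible_set0.
  by apply/negligibleP => //; exact: measurable_ball.
move=> x /existsNP[e /not_implyP[e0 /negP]]; rewrite -leNgt => mu0.
pose S : set R := [set z : R | (`|z - x| < e)%R].
have SE : S = ball x e.
  by apply/seteqP; split=> z; rewrite /S /ball /= distrC.
have oS : open S by rewrite SE; exact: ball_open.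
have [|c [q [xB BS]]] := @open_subball_rat R S x oS.
  by apply/mem_set; rewrite /S /= subrr normr0.
exists (pickle (c, q)); first exact: I.
rewrite /F pickleK; case: asboolP => [_|[]]; first exact/set_mem.
apply/eqP; rewrite eq_le measure_ge0 andbT (le_trans _ mu0)//.
apply: le_measure; rewrite ?inE//; first exact: measurable_ball.
by rewrite [X in measurable X]SE; exact: measurable_ball.
Qed.

Lemma measure_finite_set mu (t : seq R) (B : set R) : uniq t -> measurable B ->
  mu (B `&` [set` t]) = (\sum_(a <- t) mu [set a] * \d_a B)%E.
Proof.
move=> + mB; elim: t => [_|a t IHt /= /andP[at_ ut]].
  by rewrite big_nil set_nil setI0 measure0.
have mt : measurable (B `&` [set` t]).
  apply: measurableI => //; apply: countable_measurable => //.
  exact/finite_set_countable/finite_seq.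
have ma : measurable (B `&` [set a]) by exact: measurableI.
have -> : [set` a :: t] = [set a] `|` [set` t].
  by apply/seteqP; split=> z /=; rewrite inE => /predU1P.
rewrite big_cons -IHt// setIUr measureU//; last first.
  apply/seteqP; split=> // z [[_ /= ->] [_ /=]].
  by rewrite (negPf at_).
congr (_ + _)%E; rewrite diracE; have [aB|aB] := boolP (a \in B).
  by rewrite mule1; congr (mu _); apply/setIidr => _ ->; exact/set_mem.
rewrite mule0 (_ : _ `&` _ = set0) ?measure0//.
by apply/seteqP; split=> // z [zB /= za]; rewrite -za mem_set in aB.
Qed.

(** [msum] takes a family indexed by [nat], so indices outside ['I_n] are filled with the zero
    measure. *)
Definition atomic_measure n (t : 'I_n -> R) (c : 'I_n -> {nonneg R}) :
    {measure set R -> \bar R} :=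
  msum (fun k => if insub k is Some i
    then mscale (c i) (dirac (t i)) : {measure set R -> \bar R} else mzero) n.

Lemma atomic_measureE n (t : 'I_n -> R) (c : 'I_n -> {nonneg R}) (B : set R) :
  atomic_measure t c B = (\sum_i (c i)%:num%:E * \d_(t i) B)%E.
Proof. by apply: eq_bigr => i _; rewrite valK. Qed.

Lemma ge0_integral_atomic n (t : 'I_n -> R) (c : 'I_n -> {nonneg R})
    (f : R -> R) : measurable_fun setT f -> (forall x, 0 <= f x) ->
  (\int[atomic_measure t c]_x (f x)%:E = (\sum_i (c i)%:num * f (t i))%:E)%E.
Proof.
move=> mf f0; have mf' : measurable_fun setT (fun x : R => (f x)%:E).
  exact/measurable_EFinP.
rewrite ge0_integral_measure_sum//; last by move=> x _; rewrite lee_fin.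
rewrite -sumEFin; apply: eq_bigr => i _; rewrite valK.
rewrite ge0_integral_mscale//; last by move=> x _; rewrite lee_fin.
by rewrite integral_dirac// diracT mul1e EFinM.
Qed.

Lemma integral_atomic n (t : 'I_n -> R) (c : 'I_n -> {nonneg R}) (f : R -> R) :
  measurable_fun setT f ->
  (atomic_measure t c).-integrable setT (fun x : R => (f x)%:E) /\
  (\int[atomic_measure t c]_x (f x)%:E = (\sum_i (c i)%:num * f (t i))%:E)%E.
Proof.
move=> mf; split.
  apply/integrableP; split; first exact/measurable_EFinP.
  rewrite (ge0_integral_atomic t c (f := fun x => `|f x|)) ?ltry//.
  exact: measurableT_comp.
rewrite integralE.
under eq_integral do rewrite funeposE /= -EFin_max.
under [X in (_ - X)%E]eq_integral do rewrite funenegE /= -EFin_max.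
rewrite !ge0_integral_atomic//; first last.
- by move=> x; rewrite le_max lexx orbT.
- exact: measurable_maxr.
- by move=> x; rewrite le_max lexx orbT.
- by apply: measurable_maxr => //; exact: measurableT_comp.
rewrite -EFinB -sumrB; congr EFin; apply: eq_bigr => i _; rewrite -mulrBr.
congr (_ * _); rewrite /Num.max; case: ltP => ?; case: ltP => ?; lra.
Qed.

Lemma msupport_atomic n (t : 'I_n -> R) (c : 'I_n -> {nonneg R}) :
  (forall i, 0 < (c i)%:num) -> msupport (atomic_measure t c) = [set` codom t].
Proof.
move=> c0; apply/seteqP; split=> x /=.
  apply: contraPT => xt; apply/existsNP.
  (* A radius not exceeding the distance from [x] to any atom; the default 1 keeps it positive when
     there are no atoms. *)
  exists (\big[Order.min/1]_i `|t i - x|) => /(_ _).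
  set e := \big[_/_]_i _ => H.
  have e0 : 0 < e.
    apply/bigmin_gtP; split=> // i _; rewrite normr_gt0 subr_eq0.
    apply: contra xt => /eqP <-.
    exact: codom_f.
  have := H e0; rewrite atomic_measureE big1 ?ltxx// => i _.
  rewrite diracE memNset ?mule0//=; apply/negP; rewrite -leNgt.
  exact: bigmin_le.
move=> /codomP[i ->] e e0; rewrite atomic_measureE (bigD1 i)//=.
rewrite diracE mem_set /= ?subrr ?normr0// mule1.
apply: (@lt_le_trans _ _ ((c i)%:num%:E + 0)%E); first by rewrite adde0 lte_fin.
by rewrite leeD2l// sume_ge0// => j _; rewrite mule_ge0.
Qed.

Lemma atomic_represents d (y : nat -> R) n (t lam : 'I_n -> R) :
  injective t -> (forall i, 0 < lam i) -> atomic_moments y d t lam ->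
  exists mu, ratomic mu n /\ represents mu d y.
Proof.
move=> ti lam0 ylam.
pose c i : {nonneg R} := NngNum (ltW (lam0 i)).
exists (atomic_measure t c); split.
  exists (codom t); split; last by rewrite msupport_atomic.
    by rewrite map_inj_uniq ?enum_uniq.
  by rewrite size_codom card_ord.
move=> k kd; have mX : measurable_fun setT (fun x : R => x ^+ k).
  exact: measurable_funX.
have [? ->] := integral_atomic t c mX; split=> //.
by rewrite ylam.
Qed.

(** The complement of the finite support is negligible, so the measure is the sum of its point
    masses. *)
Lemma ratomic_represents d (y : nat -> R) mu n :
  ratomic mu n -> represents mu d y ->
  exists t lam : 'I_n -> R, atomic_moments y d t lam /\
    forall B, measurable B -> mu B = (\sum_i (lam i)%:E * \d_(t i) B)%E.
Proof.
move=> [u [uu su muu]] ymu; subst n.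
(* The total mass is the moment of order 0, so all point masses are finite and may serve as real
   weights. *)
have muT : (mu setT < +oo)%E.
  have [_ y0] := ymu 0%N (leq0n _).
  rewrite [X in (X < _)%E](_ : _ = (y 0%N)%:E) ?ltry//.
  by rewrite -[LHS]mul1e -integral_cst.
have mu_fin a : mu [set a] \is a fin_num.
  rewrite ge0_fin_numE// (le_lt_trans _ muT)//; apply: le_measure => //; rewrite inE//.
pose t (i : 'I_(size u)) := u`_i.
pose c i : {nonneg R} := NngNum (fine_ge0 (measure_ge0 mu [set t i])).
have muE B : measurable B -> mu B = atomic_measure t c B.
  move=> mB; rewrite atomic_measureE.
  transitivity (\sum_(a <- u) mu [set a] * \d_a B)%E; last first.
    rewrite (big_nth 0) big_mkord; apply: eq_bigr => i _ /=.
    by rewrite fineK.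
  rewrite -measure_finite_set// -muu.
  have mS : measurable (msupport mu).
    rewrite muu; apply: countable_measurable => //.
    exact/finite_set_countable/finite_seq.
  rewrite -[in LHS](setIT B) -(setUv (msupport mu)) setIUr measureU//.
  - rewrite [X in (_ + X)%E](_ : _ = 0%E) ?adde0//.
    apply/negligibleP; first by apply: measurableI => //; exact: measurableC.
    by apply: negligibleS (negligible_msupportC mu) => z [].
  - exact: measurableI.
  - by apply: measurableI => //; exact: measurableC.
  by rewrite setIACA setICr setI0.
exists t, (fun i => (c i)%:num); split=> [k kd|B mB]; last first.
  by rewrite muE// atomic_measureE.
have [_ yk] := ymu k kd; apply/EFin_inj; rewrite -yk.
rewrite (eq_measure_integral (atomic_measure t c)) => [|B mB _]; last exact: muE.
have mX : measurable_fun setT (fun x : R => x ^+ k) by exact: measurable_funX.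
by have [_ ->] := integral_atomic t c mX.
Qed.

End AtomicMeasures.

(** * The truncated moment problem of a tensor *)

(** Taking w = X yields the matrix [H3], and w = 1 - X yields [H4]. *)
Lemma riesz_quadratic_form (R : rcfType) (y : nat -> R) n (w q : {poly R}) :
  (size q <= n)%N ->
  riesz y (w * q ^+ 2) =
    ((\col_(i < n) q`_i)^T *m (\matrix_(i, j) riesz y (w * 'X^(i + j)))
      *m (\col_(i < n) q`_i)) 0 0.
Proof.
move=> sq; rewrite expr2 mulrA (riesz_mul y _ sq) mxE; apply: eq_bigr => j _.
rewrite [X in _ = _ * X]mxE mulrC; congr (_ * _).
rewrite mxE mulrAC (riesz_mul y _ sq); apply: eq_bigr => i _.
rewrite !mxE; congr (_ * riesz _ _).
by rewrite -mulrA -exprD addnC.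
Qed.

Lemma psd_H3_riesz (R : realType) s (y : nat -> R) (q : {poly R}) :
  psd (H3 s y) -> (size q <= s.+1)%N -> 0 <= riesz y ('X * q ^+ 2).
Proof.
move=> p3 sq; rewrite (riesz_quadratic_form y _ sq).
rewrite [X in _ *m X *m _](_ : _ = H3 s y); first exact: p3.
by apply/matrixP => i j; rewrite !mxE -exprS rieszXn addn1.
Qed.

Lemma psd_H4_riesz (R : realType) s (y : nat -> R) (q : {poly R}) :
  psd (H4 s y) -> (size q <= s.+1)%N -> 0 <= riesz y ((1 - 'X) * q ^+ 2).
Proof.
move=> p4 sq; rewrite (riesz_quadratic_form y _ sq).
rewrite [X in _ *m X *m _](_ : _ = H4 s y); first exact: p4.
by apply/matrixP => i j; rewrite !mxE mulrBl mul1r -exprS linearB /= !rieszXn addn1.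
Qed.

Lemma gpolyE (R : realType) r (g : 'rV[R]_r) : gpoly g = rVpoly g - 'X^r.
Proof.
rewrite /gpoly /rVpoly poly_def; congr (_ - _); apply: eq_bigr => i _.
by rewrite valK mul_polyC.
Qed.

Lemma powR_invK (R : realType) d (a : R) : (0 < d)%N -> 0 <= a ->
  (a `^ d%:R^-1) ^+ d = a.
Proof.
move=> d0 a0; rewrite -powR_mulrn ?powR_ge0// -powRrM mulVf ?powRr1//.
by rewrite pnatr_eq0 -lt0n.
Qed.

Lemma powR_exprK (R : realType) d (a : R) : (0 < d)%N -> 0 <= a ->
  (a ^+ d) `^ d%:R^-1 = a.
Proof.
move=> d0 a0; rewrite -powR_mulrn// -powRrM mulfV ?powRr1//.
by rewrite pnatr_eq0 -lt0n.
Qed.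

(* A zero vector becomes the node [0 / 0 = 0] with weight [0]. *)
Lemma cp_decomp_moments (R : realType) d n (A : tensor R d)
    (w : 'I_n -> 'cV[R]_2) : (0 < d)%N -> cp_decomp A w ->
  atomic_moments (Bvec (LT (Tmat R) A)) d
    (fun i => w i 1 0 / (w i 0 0 + w i 1 0)) (fun i => (w i 0 0 + w i 1 0) ^+ d).
Proof.
move=> d0 [w0 ->] k kd; rewrite Bvec_LT_Tmat_sum//; apply: eq_bigr => i _.
have [s0|s0] := eqVneq (w i 0 0 + w i 1 0) 0; last first.
  rewrite -[X in _ = _ ^+ X * _](subnK kd) exprD -mulrA expr_div_n; congr (_ * _).
  by rewrite mulrCA mulfV ?mulr1// expf_neq0.
have w10 : w i 1 0 = 0.
  by move/eqP: s0; rewrite paddr_eq0 ?w0// => /andP[_ /eqP].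
by rewrite s0 w10 -exprD subnK// !expr0n gtn_eqF// mul0r.
Qed.

(** [- gpoly g] is monic of degree [m], and L of its product with X^i is the defect of the i-th
    equation, so the system is exactly orthogonality. *)
Lemma sys_gpoly (R : realType) s (y : nat -> R) m (x lam : 'I_m -> R) (g : 'rV[R]_m) :
  (m <= s.+1)%N -> injective x -> (forall i, lam i != 0) ->
  atomic_moments y s.*2.+1 x lam ->
  (forall i, (i <= s.*2.+1 - m)%N ->
     \sum_(j < m) y (i + j)%N * g 0 j = y (i + m)%N) <->
  gpoly g = - \prod_i ('X - (x i)%:P).
Proof.
move=> ms xi lam0 ylam.
have sg : (size (- rVpoly g) < size ('X^m : {poly R}))%N.
  by rewrite size_polyN size_polyXn ltnS size_poly.
have Nm : - gpoly g \is monic.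
  by rewrite gpolyE opprB monicE lead_coefDl// lead_coefXn.
have Ns : size (- gpoly g) = m.+1.
  by rewrite gpolyE opprB size_polyDl// size_polyXn.
have LE i : riesz y (- gpoly g * 'X^i) =
    y (i + m)%N - \sum_(j < m) y (i + j)%N * g 0 j.
  rewrite gpolyE opprB mulrBl linearB /= -exprD rieszXn addnC; congr (_ - _).
  rewrite mulrC (@riesz_mul _ _ m) ?size_poly//; apply: eq_bigr => j _.
  by rewrite coef_rVpoly_ord -exprD rieszXn mulrC.
have [N1 N2] := node_poly_orthogonal ms xi lam0 ylam Nm Ns.
split=> [sysg|gE i im].
  by rewrite -[LHS]opprK N1// => i im; rewrite LE sysg// subrr.
have := N2; rewrite {1}gE opprK => /(_ erefl i im).
by rewrite LE => /eqP; rewrite subr_eq0 => /eqP.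
Qed.

Theorem theorem3p2 (R : realType) (s : nat) (A : tensor R s.*2.+1) :
  symmetric_tensor A ->
  let d := s.*2.+1 in
  let y := Bvec (LT (Tmat R) A) in
  0 < y 0%N -> psd (H3 s y) -> psd (H4 s y) ->
  let r := \rank (H1 s y) in
  let sys := fun g : 'rV[R]_r =>
    forall i, (i <= d - r)%N -> \sum_(j < r) y (i + j)%N * g 0 j = y (i + r)%N in
  (* (i) *)
  (exists! g, sys g) /\
  (* (ii) and (iv) *)
  (forall g, sys g ->
     exists x : 'rV[R]_r,
       [/\ injective (fun i => x 0 i),
           (forall i, 0 <= x 0 i <= 1),
           (forall i, root (gpoly g) (x 0 i)),
           (exists! lam : 'rV[R]_r, (forall i, 0 < lam 0 i) /\
               forall k, (k <= d)%N -> y k = \sum_(i < r) lam 0 i * mvec d (x 0 i) k) &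
           forall lam : 'rV[R]_r, (forall i, 0 < lam 0 i) ->
             (forall k, (k <= d)%N -> y k = \sum_(i < r) lam 0 i * mvec d (x 0 i) k) ->
             let v := fun i : 'I_r =>
               \col_(k < 2) (if k == 0 then powR (lam 0 i) d%:R^-1 * (1 - x 0 i)
                             else powR (lam 0 i) d%:R^-1 * x 0 i) in
             [/\ (forall i, 0 <= v i 0 0 /\ 0 <= v i 1 0),
                 A = (fun idx => \sum_(i < r) @tpow R d (v i) idx),
                 cp_rank_is A r &
                 forall w : 'I_r -> 'cV[R]_2, cp_decomp A w ->
                   exists p : {perm 'I_r}, forall i, w i = v (p i)]]) /\
  (* (iii) *)
  ((exists mu : {measure set R -> \bar R}, ratomic mu r /\ represents mu d y) /\
   forall mu1 mu2 : {measure set R -> \bar R},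
     ratomic mu1 r -> represents mu1 d y -> ratomic mu2 r -> represents mu2 d y ->
     forall B, measurable B -> mu1 B = mu2 B).
Proof.
move=> symA d y _ p3 p4 r sys.
have [m [x [lam [ms xi x01 lam_gt0 ylam]]]] :=
  gauss_quadrature (fun q => psd_H3_riesz p3) (fun q => psd_H4_riesz p4).
have lam0 i : lam i != 0 by rewrite gt_eqF.
have rm : r = m by rewrite -(rank_hankel ms xi lam0 ylam).
rewrite /sys => {sys}; clearbody r; subst r.
have sysE g := sys_gpoly g ms xi lam0 ylam.
have uniq := atomic_moments_unique ms xi lam0 ylam.
(* The matching of the two rules sends each node to itself, so it is the identity. *)
have same_nodes (mu : 'I_m -> R) : atomic_moments y d x mu -> forall i, mu i = lam i.
  move=> ymu i; have [_ /(_ erefl)[f [_ fx fmu]]] := uniq _ _ _ ymu.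
  by rewrite fmu -(xi _ _ (fx i)).
have d_gt0 : (0 < d)%N by [].
split; [|split; [|split]].
- pose p : {poly R} := \prod_i ('X - (x i)%:P).
  (* The leading terms cancel, so the coefficients of X^m - p fit in a row of length [m]; they are
     the solution. *)
  have sp : (size ('X^m - p)%R <= m)%N.
    have mp : p \is monic by exact: monic_prod_XsubC.
    have sp : size p = m.+1 := size_node_poly x.
    apply/leq_sizeP => j; rewrite leq_eqVlt coefB coefXn => /predU1P[<-|mj].
      by rewrite eqxx -[X in p`_X]/(m.+1.-1) -sp -lead_coefE (monicP mp) subrr.
    by rewrite gtn_eqF// nth_default ?subrr// sp.
  exists (poly_rV ('X^m - p)); split.
    by apply/sysE; rewrite gpolyE poly_rV_K// addrAC subrr add0r.
  move=> g /sysE; rewrite gpolyE => /(canRL (subrK _)) gE.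
  by apply: (can_inj rVpolyK); rewrite poly_rV_K// gE addrC.
- move=> g /sysE gE; exists (\row_i x i).
  have xE i : (\row_i x i) 0 i = x i by rewrite mxE.
  split=> [i j|i|i||].
  + by rewrite !xE => /xi.
  + by rewrite xE.
  + by rewrite gE rootN xE node_root.
  + exists (\row_i lam i); split=> [|mu [_ ymu]].
      split=> [i|k kd]; first by rewrite mxE.
      by rewrite ylam//; apply: eq_bigr => i _; rewrite !mxE.
    apply/rowP => i; rewrite mxE -(same_nodes (fun i => mu 0 i))// => k kd.
    by rewrite ymu//; apply: eq_bigr => j _; rewrite xE.
  move=> mu _ ymu; pose b i := lam i `^ d%:R^-1.
  pose v i : 'cV[R]_2 := \col_k
    (if k == 0 then mu 0 i `^ d%:R^-1 * (1 - (\row_j x j) 0 i)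
     else mu 0 i `^ d%:R^-1 * (\row_j x j) 0 i).
  have muE i : mu 0 i = lam i.
    apply: (same_nodes (fun i => mu 0 i)) => k kd.
    by rewrite ymu//; apply: eq_bigr => j _; rewrite xE.
  have v0 i : v i 0 0 = b i * (1 - x i) by rewrite !mxE /= muE.
  have v1 i : v i 1 0 = b i * x i by rewrite !mxE /= muE.
  have vD i : v i 0 0 + v i 1 0 = b i by rewrite v0 v1 -mulrDr subrK mulr1.
  have vge0 i : 0 <= v i 0 0 /\ 0 <= v i 1 0.
    have /andP[x0 x1] := x01 i.
    by rewrite v0 v1 !mulr_ge0 ?powR_ge0// subr_ge0.
  have Av : A = (fun idx => \sum_(i < m) @tpow R d (v i) idx).
    (* With coordinate sum b_i and b_i^d = lam_i, the k-th moment b_i^(d-k) (b_i x_i)^k is lam_i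
       x_i^k. *)
    apply: sum_tpow_Bvec symA _ => k kd; rewrite [LHS]ylam//; apply: eq_bigr => i _.
    rewrite vD v1 exprMn mulrA -exprD subnK// powR_invK//.
    exact: ltW.
  have cpv : cp_decomp A v.
    split=> // i k; have [] := vge0 i.
    by case: k => -[|[|//]] ?; [move=> + _|move=> _];
      congr (0 <= v i _ _); apply: val_inj.
  split; [exact: vge0|exact: Av| |].
    split; first by exists v.
    by move=> n w /(cp_decomp_moments d_gt0)/uniq[].
  move=> w cpw; have := cp_decomp_moments d_gt0 cpw.
  move=> /uniq[_ /(_ erefl)[f [fi fx flam]]]; exists (perm fi) => i.
  have [w_ge0 _] := cpw.
  (* The atom determines the vector: the d-th root of the weight is the coordinate sum, and the node
     is the share of the second coordinate. *)
  have wD : w i 0 0 + w i 1 0 = b (f i).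
    by rewrite /b -flam powR_exprK// addr_ge0.
  have b0 : b (f i) != 0 by rewrite gt_eqF// powR_gt0.
  have w1 : w i 1 0 = b (f i) * x (f i).
    by rewrite -fx wD mulrC divfK.
  have w0 : w i 0 0 = b (f i) * (1 - x (f i)).
    by rewrite mulrBr mulr1 -w1 -wD addrK.
  rewrite permE; suff -> : w i = v (f i) by [].
  apply/colP => k.
  have [->|->] : k = 0 \/ k = 1; [|by rewrite w0 v0|by rewrite w1 v1].
  by case: k => -[|[|//]] ?; [left|right]; apply: val_inj.
- exact: atomic_represents ylam.
move=> mu1 mu2 at1 re1 at2 re2 B mB.
(* Every such measure is the one carried by the nodes [x] with weights [lam]. *)
suff muE (mu : {measure set R -> \bar R}) : ratomic mu m -> represents mu d y ->
    mu B = (\sum_i (lam i)%:E * \d_(x i) B)%E by rewrite !muE.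
move=> atm rem; have [t [c [yc ->//]]] := ratomic_represents atm rem.
have [_ /(_ erefl)[f [fi ft fc]]] := uniq _ _ _ yc.
rewrite [RHS](reindex_inj fi); apply: eq_bigr => i _.
by rewrite ft fc.
Qed.
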